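(* Let $K$ be a field of prime characteristic $p$ and let $L/K$ be a finite field extension. Write $G=G(L/K)$. Then: 1. $$\mathcal{D}(L/K)=\mathcal{D}(L/L_{dif})=\mathcal{D}\Big(L^{G}\otimes_{L^{G}_{dif}}L_{dif}\,/\,L^{G}_{dif}\Big)=L_{dif}\otimes_{L^{G}_{dif}}\mathcal{D}\Big(L^{G}/L^{G}_{dif}\Big).$$ In particular, each differential operator in $\mathcal{D}\big(L^{G}/L^{G}_{dif}\big)$ can be uniquely lifted to a differential operator in $\mathcal{D}(L/K)$. 2. If, in addition, $L^{G}_{dif}=K$ (equivalently, $L=L^{G}\otimes_K L_{dif}$), i.e. $L/K$ is a B-extension, then $\mathcal{D}(L/K)=\mathcal{D}(L^{G}\otimes_K L_{dif}/K)=L_{dif}\otimes_K\mathcal{D}(L^{G}/K)$.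
   Context: For a finite field extension $L/K$: $E(L/K)=\mathrm{End}_K(L)$; $L$ is viewed as a subfield of $E(L/K)$ via multiplication operators. $G(L/K)=\mathrm{Aut}_{K\text{-alg}}(L)\subseteq E(L/K)$ and $L^{G(L/K)}$ is its fixed field. $\mathcal{D}(L/K)=\bigcup_{i\ge0}\mathcal{D}_i\subseteq E(L/K)$ is the algebra of $K$-linear differential operators on $L$, where $\mathcal{D}_0=L$ and $\mathcal{D}_i=\{\delta\in E(L/K)\mid\delta l-l\delta\in\mathcal{D}_{i-1}\text{ for all }l\in L\}$; the same notation is used for other finite extensions. $L_{dif}=\{l\in L\mid l\delta=\delta l\text{ for all }\delta\in\mathcal{D}(L/K)\}$ and $L^{G(L/K)}_{dif}:=L^{G(L/K)}\cap L_{dif}$. For every finite extension $L/K$ of characteristic $p$ the multiplication map identifies $L=L^{G(L/K)}\otimes_{L^{G(L/K)}_{dif}}L_{dif}$, and correspondingly (with $F=L^{G(L/K)}_{dif}$) $E(L/F)=E(L^{G(L/K)}/F)\otimes_F E(L_{dif}/F)$; the tensor products of subalgebras in the statement are regarded inside this algebra. $L/K$ is a B-extension if $E(L/K)$ is generated as a $K$-algebra by $\mathcal{D}(L/K)$ and $G(L/K)$. *)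

(* Defs.v *)
From HB Require Import structures.
From mathcomp Require Import all_boot all_order all_algebra all_field.
From mathcomp Require Import boolp classical_sets.

Set Implicit Arguments.
Unset Strict Implicit.
Unset Printing Implicit Defensive.

Import GRing.Theory.
Local Open Scope ring_scope.
Local Open Scope classical_set_scope.

(* Operators on an algebra are bare functions, so that the operators of L/K   *)
(* and those of L/F for an intermediate field F (i.e. of [fieldOver F], whose *)
(* carrier is that of L) live in the same type.                               *)

Section Operators.
Variables (K : fieldType) (T : comAlgType K).

Definition endop : set (T -> T) := [set f | linear f].

Definition mulop : set (T -> T) := [set f | exists l : T, f = *%R l].

Fixpoint diffop_ord (i : nat) : set (T -> T) :=
  if i is j.+1 then
    [set f | endop f /\
      forall l : T, diffop_ord j (fun x => f (l * x) - l * f x)]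
  else mulop.

Definition diffop : set (T -> T) := \bigcup_i diffop_ord i.

Definition subalg_op (P : set (T -> T)) : Prop :=
  [/\ P idfun,
      forall (c : K) f g, P f -> P g -> P (fun x => c *: f x + g x)
    & forall f g, P f -> P g -> P (f \o g)].

Definition gen_subalg (S : set (T -> T)) : set (T -> T) :=
  [set f | forall P, subalg_op P -> S `<=` P -> P f].

End Operators.

Arguments endop {K} T.
Arguments mulop {K} T.
Arguments diffop_ord {K} T i.
Arguments diffop {K} T.

Section TensorProduct.
Variables (K : fieldType) (A B T : lmodType K).

Definition bilinear_map (t : A -> B -> T) : Prop :=
  (forall a, linear (t a)) /\ (forall b, linear (t^~ b)).

End TensorProduct.

(* t exhibits T as the tensor product of A and B over K (universal property). *)
Definition is_tensor (K : fieldType) (A B T : lmodType K)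
    (t : A -> B -> T) : Prop :=
  bilinear_map t /\
  forall (W : lmodType K) (u : A -> B -> W), bilinear_map u ->
    exists! h : T -> W, linear h /\ forall a b, h (t a b) = u a b.

Section Extension.
Variables (K : fieldType) (L : fieldExtType K).

Definition galop : set (L -> L) :=
  [set g | [/\ linear g, monoid_morphism g & bijective g]].

Definition is_Bext : Prop :=
  gen_subalg (diffop L `|` galop) = endop L.

(* The subfield with underlying set P; junk if P is not a subextension. *)
Definition subfield_of (P : set L) : {subfield L} :=
  xget 1%AS [set U : {subfield L} | forall x, x \in U <-> P x].

Lemma subfield_ofP (P : set L) :
    P 1 -> (forall (c : K) x y, P x -> P y -> P (c *: x + y)) ->
    (forall x y, P x -> P y -> P (x * y)) ->
  forall x, x \in subfield_of P <-> P x.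
Proof.
move=> P1 PD PM.
suff exU : exists U : {subfield L}, forall x, x \in U <-> P x.
  exact: (xgetPex 1%AS exU).
have P0 : P 0 by have := PD (-1) _ _ P1 P1; rewrite scaleN1r addNr.
pose Q (n : nat) := `[< exists2 V : {vspace L}, \dim V = n & {in V, forall x, P x} >].
have exQ : exists n, Q n.
  exists 0; apply/asboolP; exists 0%VS; first exact: dimv0.
  by move=> x; rewrite memv0 => /eqP->.
have ubQ n : Q n -> (n <= \dim {:L})%N.
  by move=> /asboolP[V <- _]; apply: dimvS; apply: subvf.
case: (ex_maxnP exQ ubQ) => n /asboolP[V dimV VP] maxV.
have PV x : P x -> x \in V.
  move=> Px; have: (\dim (<[x]> + V) <= \dim V)%N.
    rewrite dimV; apply: maxV; apply/asboolP; exists (<[x]> + V)%VS => // y.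
    by case/memv_addP=> _ /vlineP[c ->] [v /VP Pv ->]; apply: PD.
  move=> le; have /eqP-> : V == (<[x]> + V)%VS by rewrite eqEdim addvSr.
  by apply: (subvP (addvSl _ _)); apply: memv_line.
have VA : is_aspace V.
  apply/andP; split; first by apply: has_algid1; apply: PV.
  by apply/prodvP => x y /VP Px /VP Py; apply: PV; apply: PM.
exists (ASpace VA) => x; split=> [xV | /PV //]; exact: (VP x xV).
Qed.

Definition fixG : {subfield L} :=
  subfield_of [set x | forall g, galop g -> g x = x].

Lemma fixGP x : x \in fixG <-> forall g, galop g -> g x = x.
Proof.
apply: (subfield_ofP (P := [set x | _])).
- by move=> g [_ [] ].
- by move=> c y z Py Pz g Gg; have [lg _ _] := Gg; rewrite lg Py // Pz.
- by move=> y z Py Pz g Gg; have [_ [_ gM] _] := Gg; rewrite gM Py // Pz.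
Qed.

Definition dif : {subfield L} :=
  subfield_of [set l | forall d, diffop L d -> *%R l \o d = d \o *%R l].

Lemma diffop_linear d : diffop L d -> linear d.
Proof.
case=> [[|i]] _ /=; last by case.
by case=> l -> c x y; rewrite mulrDr scalerAr.
Qed.

Lemma difP l :
  l \in dif <-> forall d, diffop L d -> *%R l \o d = d \o *%R l.
Proof.
apply: (subfield_ofP (P := [set l | _])).
- by move=> d _; apply/funext => x /=; rewrite !mul1r.
- move=> c y z Py Pz d Dd; apply/funext => x /=.
  rewrite !mulrDl -!scalerAl (diffop_linear Dd).
  by move/(congr1 (@^~ x)): (Py d Dd) => /= ->;
     move/(congr1 (@^~ x)): (Pz d Dd) => /= ->.
- move=> y z Py Pz d Dd; apply/funext => x /=; rewrite -!mulrA.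
  move/(congr1 (@^~ x)): (Pz d Dd) => /= ->.
  by move/(congr1 (@^~ (z * x))): (Py d Dd) => /= ->.
Qed.

Definition fixGdif : {subfield L} := (fixG :&: dif)%AS.

Section Tensor.
Variables A B : {subfield L}.

Definition mul_tensor : Prop :=
  is_tensor (fun (a : subvs_of A) (b : subvs_of B) => vsval a * vsval b : L).

(* The differential operators of the K-algebra A (x)_K B, transported to L    *)
(* along the multiplication map phi : A (x)_K B -> L; the tensor product is   *)
(* any algebra T with maps i, j from A, B such that i a * j b is universal.   *)
Definition diffop_tensor : set (L -> L) :=
  [set f : L -> L | exists (T : comAlgType K) (i : {lrmorphism subvs_of A -> T})
             (j : {lrmorphism subvs_of B -> T}) (phi : {lrmorphism T -> L})
             (d : T -> T),
    [/\ is_tensor (fun a b => i a * j b),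
        forall a b, phi (i a * j b) = vsval a * vsval b,
        bijective phi, diffop T d & f \o phi = phi \o d]].

(* g is d (x) e, under the identification of A (x)_K B with L. *)
Definition is_tensor_op (d : subvs_of A -> subvs_of A)
    (e : subvs_of B -> subvs_of B) (g : L -> L) : Prop :=
  linear g /\
  forall a b, g (vsval a * vsval b) = vsval (d a) * vsval (e b).

(* S (x)_K T as a subset of End_K(L), for subspaces S and T of the operators  *)
(* on A and on B: the finite sums of operators d (x) e, d in S, e in T.       *)
Definition tensor_op (S : set (subvs_of A -> subvs_of A))
    (T : set (subvs_of B -> subvs_of B)) : set (L -> L) :=
  [set f | exists (n : nat) (g : 'I_n -> L -> L),
    (forall k, exists d e, [/\ S d, T e & is_tensor_op d e (g k)]) /\
    f = (fun x => \sum_k g k x)].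

End Tensor.

End Extension.

Arguments galop {K} L.
Arguments is_Bext {K} L.
Arguments fixG {K} L.
Arguments dif {K} L.
Arguments fixGdif {K} L.

(* L^G and L_dif as extensions of F = L^G \cap L_dif, inside L/F. *)
Definition fixG_over (K : fieldType) (L : fieldExtType K) :
  {subfield fieldOver (fixGdif L)} := aspaceOver (fixGdif L) (fixG L).

Definition dif_over (K : fieldType) (L : fieldExtType K) :
  {subfield fieldOver (fixGdif L)} := aspaceOver (fixGdif L) (dif L).

Arguments fixG_over {K} L.
Arguments dif_over {K} L.

(* Main.v *)
Require Import Defs.
From HB Require Import structures.
From mathcomp Require Import all_boot all_order all_algebra all_field.
From mathcomp Require Import boolp classical_sets.

(* An operator of order i commutes with every p^i-th power, so L^(p^n) lies in *)
(* L_dif for some n; in particular automorphisms of L that agree on L_dif are  *)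
(* equal, and Dedekind independence of G already holds on L_dif.  Dualizing    *)
(* the L_dif-span of G by elements x_j of L_dif gives operators d_j with       *)
(* values in L^G such that l = \sum_j x_j d_j(l): this is the isomorphism      *)
(* L = L^G (x)_F L_dif.  Since differential operators are L_dif-linear, their  *)
(* coordinates in (x_j) are differential operators on L^G.  The criterion for  *)
(* B-extensions is the Jacobson-Bourbaki theorem, because the centralizer of   *)
(* D(L/K) and G in L is F.                                                     *)

Set Implicit Arguments.
Unset Strict Implicit.
Unset Printing Implicit Defensive.

Import GRing.Theory.
Local Open Scope ring_scope.
Local Open Scope classical_set_scope.

(** Let F be the intersection of L^G and L_dif. Everything rests on one family x_j in L_dif, with
    coordinate functions d_j, produced by [fixG_dif_split]. It is a basis of L over L^G, and each
    d_j maps L_dif into F, so the x_j also span L_dif over F. Hence L is the tensor product of L^G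
    and L_dif over F ([split_mul_tensor]).

    A differential operator is L_dif-linear, so it is determined by its restriction to L^G, and the
    coordinates of that restriction are differential operators on L^G ([diffop_ord_coef]).
    Conversely, an operator e on L^G extends to id (x) e on L without raising its order
    ([diffop_ord_split_lift]). This gives the tensor decomposition and the unique lifts. Replacing K
    by F or L_dif does not change the differential operators ([diffop_fieldOver]).

    For B-extensions, [Jacobson_Bourbaki] shows that the algebra generated by operators and
    automorphisms contains every F-linear map when F = K. *)

Section LinearFunction.
Variables (K : fieldType) (U V : lmodType K) (f : U -> V).
Hypothesis fl : linear f.

Lemma linear_fun_sum n (F : 'I_n -> U) : f (\sum_i F i) = \sum_i f (F i).
Proof.
pose lf := GRing.isLinear.Build _ _ _ _ f fl.
pose g : {linear U -> V} := HB.pack f lf.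
exact: (linear_sum g).
Qed.

Lemma linear_fun0 : f 0 = 0.
Proof. by have := fl (-1) 0 0; rewrite scaler0 addr0 scaleN1r addNr. Qed.

Lemma linear_funD x y : f (x + y) = f x + f y.
Proof. by have := fl 1 x y; rewrite !scale1r. Qed.

Lemma linear_funZ c x : f (c *: x) = c *: f x.
Proof. by have := fl c x 0; rewrite !addr0 linear_fun0 addr0. Qed.

Lemma linear_funB x y : f (x - y) = f x - f y.
Proof. by rewrite linear_funD -[- y]scaleN1r linear_funZ scaleN1r. Qed.

End LinearFunction.

Lemma lincomb_closed (T : Type) (R : pzRingType) (C : {pred R})
    (P : set (T -> R)) :
    P (fun=> 0) ->
    (forall c f g, c \in C -> P f -> P g -> P (fun x => c * f x + g x)) ->
  forall n (c : 'I_n -> R) f, (forall i, c i \in C) -> (forall i, P (f i)) ->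
    P (fun x => \sum_i c i * f i x).
Proof.
move=> P0 PD; elim=> [|n IHn] c f cC Pf.
  by congr P: P0; apply/funext => x; rewrite big_ord0.
have := PD _ _ _ (cC ord0) (Pf ord0)
  (IHn _ _ (fun j => cC (lift ord0 j)) (fun j => Pf (lift ord0 j))).
by congr P; apply/funext => x; rewrite big_ord_recl.
Qed.

(** * Differential operators on a commutative algebra *)

Section DifferentialOperators.
Variables (K : fieldType) (T : comAlgType K).
Implicit Types (f g d : T -> T) (l x : T).

Lemma diffop_ord_linear i d : diffop_ord T i d -> linear d.
Proof.
case: i => [|i] /=; last by case.
by case=> l -> c x y; rewrite mulrDr scalerAr.
Qed.

Lemma diffop_ordS i : diffop_ord T i `<=` diffop_ord T i.+1.
Proof.
elim: i => [|i IHi] d Dd; split; try exact: diffop_ord_linear Dd.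
  case: Dd => m -> l; exists 0; apply/funext => x.
  by rewrite mul0r !mulrA (mulrC m) subrr.
by case: Dd => _ Dd l; apply: IHi; apply: Dd.
Qed.

Lemma diffop_ord_le i j : (i <= j)%N -> diffop_ord T i `<=` diffop_ord T j.
Proof.
move=> /subnKC <-; elim: (j - i)%N => [|k IHk]; first by rewrite addn0.
by rewrite addnS => d /IHk; apply: diffop_ordS.
Qed.

Lemma diffop_ordD i l f g : diffop_ord T i f -> diffop_ord T i g ->
  diffop_ord T i (fun x => l * f x + g x).
Proof.
elim: i f g => [|i IHi] f g /=.
  case=> a -> [b ->]; exists (l * a + b); apply/funext => x.
  by rewrite mulrDl mulrA.
move=> [fl Df] [gl Dg]; split=> [c x y | m].
  by rewrite fl gl !mulrDr scalerDr -scalerAr -!addrA; congr (_ + _); rewrite addrCA.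
have := IHi _ _ (Df m) (Dg m); congr (diffop_ord T i _); apply/funext => x.
by rewrite mulrBr mulrDr opprD !mulrA (mulrC l m) addrACA.
Qed.

Lemma diffop_ord0 i : diffop_ord T i (fun=> 0).
Proof.
apply: (@diffop_ord_le 0) => //; exists 0.
by apply/funext => x; rewrite mul0r.
Qed.

Lemma diffop_ord_sum i n (l : 'I_n -> T) (f : 'I_n -> T -> T) :
  (forall k, diffop_ord T i (f k)) -> diffop_ord T i (fun x => \sum_k l k * f k x).
Proof.
move=> Df; apply: (lincomb_closed (C := predT)) => //; first exact: diffop_ord0.
by move=> c g h _; apply: diffop_ordD.
Qed.

Lemma diffop0 : diffop T (fun=> 0).
Proof. by exists 0%N => //; apply: diffop_ord0. Qed.

Lemma diffop_mul l : diffop T ( *%R l).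
Proof. by exists 0%N => //; exists l. Qed.

Lemma diffopD l f g : diffop T f -> diffop T g ->
  diffop T (fun x => l * f x + g x).
Proof.
move=> [i _ Df] [j _ Dg]; exists (maxn i j) => //; apply: diffop_ordD.
  exact: diffop_ord_le (leq_maxl _ _) _ Df.
exact: diffop_ord_le (leq_maxr _ _) _ Dg.
Qed.

Lemma diffop_sum n (l : 'I_n -> T) (f : 'I_n -> T -> T) :
  (forall k, diffop T (f k)) -> diffop T (fun x => \sum_k l k * f k x).
Proof.
move=> Df; apply: (lincomb_closed (C := predT)) => //; first exact: diffop0.
by move=> c g h _; apply: diffopD.
Qed.

(* If [d, m] commutes with m, then [d, m^k] = k m^(k-1) [d, m], which vanishes *)
(* for k = p: this gains one power of p at each order.                         *)
Lemma diffop_ord_commX p (charT : p%:R = 0 :> T) i d l x :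
  diffop_ord T i d -> d (l ^+ (p ^ i) * x) = l ^+ (p ^ i) * d x.
Proof.
elim: i d x => [|i IHi] d x; first by case=> m ->; rewrite mulrCA.
case=> _; set m := l ^+ (p ^ i) in IHi * => /(_ m) De.
pose e y := d (m * y) - m * d y.
have em y : e (m * y) = m * e y by apply: (IHi e).
have dm y : d (m * y) = m * d y + e y by rewrite addrC /e subrK.
have dmX k y : d (m ^+ k.+1 * y) = m ^+ k.+1 * d y + (m ^+ k * e y) *+ k.+1.
  elim: k y => [|k IHk] y; first by rewrite expr0 mul1r dm.
  rewrite exprSr -mulrA IHk dm em mulrDr [in RHS]mulrSr -!addrA mulrA.
  by congr (_ + _); rewrite addrC mulrA -exprSr.
(* The hypothesis [charT] allows p = 0; the exponent is then 0 and the claim is trivial. *)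
rewrite expnSr exprM -/m; clearbody m; case: p charT IHi => [|k] charT _.
  by rewrite !expr0 !mul1r.
by rewrite dmX -[X in _ + X]mulr_natl charT mul0r addr0.
Qed.

End DifferentialOperators.

(** If f and d correspond under phi, so do the commutators [f, phi l] and [d, l]. This serves both
    conjugation by automorphisms and transport from an abstract tensor product. *)
Lemma diffop_ord_transport (K : fieldType) (T T' : comAlgType K)
    (phi : T -> T') (psi : T' -> T) (i : nat) (d : T -> T) (f : T' -> T') :
  linear phi -> {morph phi : x y / x * y} -> cancel psi phi ->
  f \o phi = phi \o d -> diffop_ord T i d -> diffop_ord T' i f.
Proof.
move=> phil phiM psiK; elim: i d f => [|i IHi] d f fd.
  move=> [l dE]; exists (phi l); apply/funext => x.
  by rewrite -(psiK x); move/(congr1 (@^~ (psi x))): fd => /= ->; rewrite dE phiM.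
have {}fd x : f (phi x) = phi (d x) by move/(congr1 (@^~ x)): fd.
move=> [dl Dd]; split=> [c x y | l].
  by rewrite -(psiK x) -(psiK y) -phil !fd dl phil.
apply: IHi (Dd (psi l)); apply/funext => x /=.
by rewrite -{1 2}(psiK l) -phiM !fd (linear_funB phil) phiM.
Qed.

(** * Dual systems of vectors and operators *)

Section DualSystem.
Variables (K : fieldType) (L : fieldExtType K).

(* A maximal system of vectors and operators with f_i (x_j) = delta_ij is a    *)
(* pair of dual bases: an operator f outside the span of the f_j would enlarge *)
(* it after normalizing f - \sum_j f (x_j) f_j at a point where it is nonzero. *)
Lemma dual_system (S : {subfield L}) (P : set (L -> L)) :
    P (fun=> 0) -> (forall f, P f -> linear f) ->
    (forall c f g, c \in S -> P f -> P g -> P (fun x => c * f x + g x)) ->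
    (forall f x, P f -> x \in S -> f x \in S) ->
  exists (n : nat) (x : 'I_n -> L) (f : 'I_n -> L -> L),
    [/\ forall j, x j \in S, forall j, P (f j),
        forall i j, f i (x j) = (i == j)%:R
      & forall g y, P g -> y \in S -> g y = \sum_j g (x j) * f j y].
Proof.
move=> P0 Pl PD PS.
pose Q n := `[< exists (x : 'I_n -> L) (f : 'I_n -> L -> L),
  [/\ forall j, x j \in S, forall j, P (f j)
    & forall i j, f i (x j) = (i == j)%:R] >].
have exQ : exists n, Q n.
  by exists 0%N; apply/asboolP; exists (fun=> 0), (fun=> id); split=> -[].
have ubQ n : Q n -> (n <= \dim {:L})%N.
  move=> /asboolP[x [f [_ Pf fx]]].
  pose X := mktuple x.
  have frX : free X.
    apply/freeP => k kX i; have := congr1 (f i) kX.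
    rewrite (linear_fun0 (Pl _ (Pf i))) (linear_fun_sum (Pl _ (Pf i))).
    rewrite (bigD1 i) //= big1 => [|j jNi].
      rewrite nth_mktuple (linear_funZ (Pl _ (Pf i))) fx eqxx addr0.
      by move/eqP; rewrite scaler_eq0 oner_eq0 orbF => /eqP.
    rewrite nth_mktuple (linear_funZ (Pl _ (Pf i))) fx eq_sym.
    by rewrite (negPf jNi) scaler0.
  by move: frX; rewrite /free size_tuple => /eqP <-; apply/dimvS/subvf.
case: (ex_maxnP exQ ubQ) => n /asboolP[x [f [xS Pf fx]]] maxn.
exists n, x, f; split=> // g y Pg yS.
have PB h h' : P h -> P h' -> P (fun z => h z - h' z).
  move=> Ph Ph'; have := PD (-1) h' h; rewrite rpredN rpred1 => /(_ isT Ph' Ph).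
  by congr P; apply/funext => z; rewrite mulN1r addrC.
pose e z := g z - \sum_j g (x j) * f j z.
have Pe : P e by apply: (PB) => //; apply: (lincomb_closed P0 PD) => // j; apply: PS.
have ex j : e (x j) = 0.
  rewrite /e (bigD1 j) //= fx eqxx mulr1 big1 ?addr0 ?subrr // => i iNj.
  by rewrite fx (negPf iNj) mulr0.
have [/eqP|ey] := eqVneq (e y) 0; first by rewrite subr_eq0 => /eqP.
have {ey}: Q n.+1.
  pose h z := (e y)^-1 * e z.
  have Ph : P h.
    have eS : (e y)^-1 \in S by rewrite rpredV; apply: PS.
    by have := PD _ _ _ eS Pe P0; congr P; apply/funext => z; rewrite addr0.
  have hy : h y = 1 by rewrite /h mulVf.
  have hx j : h (x j) = 0 by rewrite /h ex mulr0.
  (* The index [ord_max] carries the new pair (y, h); subtracting f_j(y) h from f_j makes the old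
     operators vanish at y. *)
  apply/asboolP; exists (fun j => oapp x y (unlift ord_max j)).
  exists (fun j => oapp (fun j z => f j z - f j y * h z) h (unlift ord_max j)).
  split=> [j | j | i j].
  - by case: unliftP => [k _|_] /=.
  - case: unliftP => [k _|_] //=; apply: PB => //.
    have := PD _ _ _ (PS _ _ (Pf k) yS) Ph P0.
    by congr P; apply/funext => z; rewrite addr0.
  - case: (unliftP ord_max i) => [k|] -> /=;
      case: (unliftP ord_max j) => [m|] -> /=.
    + by rewrite hx mulr0 subr0 fx (inj_eq lift_inj).
    + by rewrite hy mulr1 subrr eq_sym (negPf (neq_lift _ _)).
    + by rewrite hx (negPf (neq_lift _ _)).
    + by rewrite hy eqxx.
by move/maxn; rewrite ltnn.
Qed.

End DualSystem.

(** * Automorphisms and the field L_dif *)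

Lemma expr_pchar_inj (F : fieldType) p n : p \in [pchar F] ->
  injective (fun x : F => x ^+ (p ^ n)).
Proof.
move=> charF; elim: n => [|n IHn] x y /=; first by rewrite !expr1.
rewrite expnSr !exprM => /(fmorph_inj (pFrobenius_aut charF)); exact: IHn.
Qed.

Section DifAndGalois.
Variables (K : fieldType) (L : fieldExtType K).
Implicit Types (d f g : L -> L) (P : set (L -> L)).

Lemma galop_id : galop L idfun.
Proof. by split=> //; exists idfun. Qed.

Lemma galop_comp g h : galop L g -> galop L h -> galop L (g \o h).
Proof.
move=> [gl [g1 gM] gb] [hl [h1 hM] hb]; split; last exact: bij_comp.
  by move=> c x y /=; rewrite hl gl.
by split=> [|x y] /=; rewrite ?h1 // hM gM.
Qed.

Lemma dif_comm d l x : l \in dif L -> diffop L d -> d (l * x) = l * d x.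
Proof. by move=> /difP lD /lD /(congr1 (@^~ x)). Qed.

Lemma fixG_fix g x : x \in fixG L -> galop L g -> g x = x.
Proof. by move=> /fixGP xG /xG. Qed.

Lemma diffop_ord_conj g h i d : galop L g -> cancel h g -> diffop_ord L i d ->
  diffop_ord L i (g \o d \o h).
Proof.
move=> [gl [_ gM] gb] hK; apply: (diffop_ord_transport gl gM hK).
by apply/funext => x /=; rewrite (proj1 (bij_can_sym gb h) hK).
Qed.

Lemma galop_inv g : galop L g -> exists2 h, galop L h & cancel h g /\ cancel g h.
Proof.
move=> [gl [g1 gM] gb]; have [h gK hK] := gb; exists h; last by [].
split; last by exists g.
  by move=> c x y; apply: (can_inj gK); rewrite gl !hK.
by split=> [|x y]; apply: (can_inj gK); rewrite ?gM ?hK.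
Qed.

(** Conjugation by g preserves the differential operators, hence g preserves their centralizer in
    L. *)
Lemma galop_dif g x : galop L g -> x \in dif L -> g x \in dif L.
Proof.
move=> Gg xD; have [h Gh [hK gK]] := galop_inv Gg.
have [gl [_ gM] gb] := Gg.
apply/difP => d [i _ Dd]; apply/funext => y /=.
have Dhdg : diffop L (h \o d \o g) by exists i => //; apply: diffop_ord_conj Dd.
have /(congr1 g) := dif_comm (h y) xD Dhdg.
by rewrite gM /= !hK gM hK.
Qed.

(** The differential operators have a finite L-basis, taken from a dual system; the largest order
    occurring in it gives one exponent n valid for all operators. *)
Lemma dif_inseparable p : p \in [pchar K] -> exists n, forall l, l ^+ (p ^ n) \in dif L.
Proof.
move=> charK.
have charL : p%:R = 0 :> L by apply: pcharf0; rewrite (pchar_lalg L).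
have [] := @dual_system K L {:L}%AS (diffop L).
- exact: diffop0.
- exact: diffop_linear.
- by move=> c f g _; apply: diffopD.
- by move=> f x _ _; apply: memvf.
move=> n [x [d [_ Dd _ dE]]].
have /choice[o Do] j : exists i, diffop_ord L i (d j).
  by have [i _ Di] := Dd j; exists i.
exists (\max_j o j)%N => l; apply/difP => f Df; apply/funext => y /=.
rewrite (dE f y) ?memvf // (dE f (_ * y)) ?memvf // mulr_sumr.
apply: eq_bigr => j _; rewrite mulrCA; congr (_ * _).
by rewrite (diffop_ord_commX charL _ _ (diffop_ord_le (leq_bigmax j) (Do j))).
Qed.

Lemma galop_eq_on_dif p g h : p \in [pchar K] -> galop L g -> galop L h ->
  {in dif L, g =1 h} -> g =1 h.
Proof.
move=> charK [gl [g1 gM] _] [hl [h1 hM] _] gh x.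
have [n nP] := dif_inseparable charK.
have charL : p \in [pchar L] by rewrite (pchar_lalg L).
have morphX (k : L -> L) : k 1 = 1 -> {morph k : x y / x * y} ->
    forall m y, k (y ^+ m) = k y ^+ m.
  by move=> k1 kM; elim=> [|m IHm] y; rewrite ?k1 // !exprS kM IHm.
have expI := @expr_pchar_inj L p n charL; apply: expI.
by rewrite /= -(morphX g) // -(morphX h) //; apply: gh.
Qed.

End DifAndGalois.

(** * A basis of L over L^G inside L_dif *)

Section Splitting.
Variables (K : fieldType) (L : fieldExtType K) (p : nat).
Hypothesis charK : p \in [pchar K].
Implicit Types (f g h : L -> L).

(* Dedekind's independence argument, on L_dif, where distinct automorphisms of *)
(* L remain distinct.                                                          *)
Lemma galop_comb_dif n (c : 'I_n -> L) (g : 'I_n -> L -> L) :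
  (forall i, galop L (g i)) ->
  {in dif L, forall s, \sum_i c i * g i s = 0} ->
  forall x, \sum_i c i * g i x = 0.
Proof.
elim: n c g => [|n IHn] c g Gg cg0 x; first by rewrite big_ord0.
pose f y := \sum_i c i * g i y; rewrite -/(f x).
have gM i : {morph g i : y z / y * z} by case: (Gg i) => _ [].
(* The k-th term cancels in f(s y) - g_k(s) f(y), leaving a shorter combination that still vanishes
   on L_dif. If f is nonzero somewhere, all g_k then agree on L_dif, hence on L. *)
have fM k s : s \in dif L -> forall y, f (s * y) = g k s * f y.
  move=> sD y; apply/eqP; rewrite -subr_eq0; apply/eqP.
  have fE z : f (s * z) - g k s * f z =
      \sum_i (c (lift k i) * (g (lift k i) s - g k s)) * g (lift k i) z.
    rewrite /f mulr_sumr -sumrB (bigD1_ord k) //= gM mulrCA subrr add0r.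
    by apply: eq_bigr => i _; rewrite gM mulrBr mulrBl !mulrA (mulrC (g k s)).
  rewrite fE; apply: (IHn (fun i => c _ * _) (fun i => g (lift k i))) => [i|z zD].
    exact: Gg.
  by rewrite -fE {1}/f cg0 ?rpredM // {1}/f cg0 // mulr0 subrr.
have [//|fx] := eqVneq (f x) 0.
have gE k : g k =1 g ord0.
  apply: (galop_eq_on_dif charK (Gg _) (Gg _)) => s sD.
  by apply: (mulIf fx); rewrite -!fM.
have fE y : f y = (\sum_i c i) * g ord0 y.
  by rewrite /f mulr_suml; apply: eq_bigr => i _; rewrite gE.
have := cg0 1 (rpred1 _); rewrite -/(f 1) fE.
by have [_ [-> _] _] := Gg ord0; rewrite mulr1 fE => ->; rewrite mul0r.
Qed.

(** The L_dif-span of G. Repetitions among the g_i are allowed, so G need not be enumerated. *)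
Let galspan : set (L -> L) := [set f | exists n (c : 'I_n -> L) (g : 'I_n -> L -> L),
  [/\ forall i, c i \in dif L, forall i, galop L (g i)
    & f = fun x => \sum_i c i * g i x]].

Lemma galspanD c f g : c \in dif L -> galspan f -> galspan g ->
  galspan (fun x => c * f x + g x).
Proof.
move=> cD [m [a [u [aD Gu ->]]]] [n [b [v [bD Gv ->]]]].
exists (m + n)%N, (fun k => match split k with inl i => c * a i | inr j => b j end).
exists (fun k => match split k with inl i => u i | inr j => v j end).
split=> [k | k |]; first by case: (split k) => i //; apply: rpredM.
  by case: (split k).
apply/funext => x; rewrite big_split_ord mulr_sumr /=; congr (_ + _).
  by apply: eq_bigr => i _; rewrite (unsplitK (inl i)) mulrA.
by apply: eq_bigr => i _; rewrite (unsplitK (inr i)).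
Qed.

Lemma galspan_id : galspan idfun.
Proof.
exists 1%N, (fun=> 1), (fun=> idfun); split=> [i | i |].
- exact: rpred1.
- exact: galop_id.
- by apply/funext => x; rewrite big_ord1 mul1r.
Qed.

Lemma galspan_galop g f : galop L g -> galspan f -> galspan (g \o f).
Proof.
move=> Gg [n [c [h [cD Gh ->]]]].
exists n, (g \o c), (fun i => g \o h i); split=> [i | i |].
- exact: galop_dif.
- exact: galop_comp.
- have [gl [_ gM] _] := Gg; apply/funext => x /=.
  by rewrite (linear_fun_sum gl); apply: eq_bigr => i _; rewrite gM.
Qed.

(* The x_j form a basis of L over L^G consisting of elements of L_dif, and the *)
(* d_j are its coordinate functions.                                           *)
Lemma fixG_dif_split : exists n (x : 'I_n -> L) (d : 'I_n -> L -> L),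
  [/\ forall j, x j \in dif L,
      forall j l, d j l \in fixG L,
      forall j b, b \in dif L -> d j b \in dif L,
      forall j a l m, a \in fixG L -> d j (a * l + m) = a * d j l + d j m
    & forall l, l = \sum_j x j * d j l].
Proof.
have galspan_linear f : galspan f -> forall a, a \in fixG L ->
    forall l m, f (a * l + m) = a * f l + f m.
  case=> n [c [g [_ Gg ->]]] a aG l m.
  rewrite mulr_sumr -big_split; apply: eq_bigr => i _ /=.
  have [gl [_ gM] _] := Gg i.
  by rewrite (linear_funD gl) gM (fixG_fix aG (Gg i)) mulrDr mulrCA.
have galspan_dif f s : galspan f -> s \in dif L -> f s \in dif L.
  case=> n [c [g [cD Gg ->]]] sD; apply: rpred_sum => i _.
  by rewrite rpredM //; apply: galop_dif.
have galspan0 : galspan (fun=> 0).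
  exists 0%N, (fun=> 0), (fun=> id); split=> [[]|[]|] //.
  by apply/funext => x; rewrite big_ord0.
have [] := @dual_system K L (dif L) galspan => //.
- move=> f Pf c x y; have := galspan_linear f Pf c%:A _ x y.
  by rewrite !mulr_algl; apply; rewrite rpredZ ?rpred1.
- exact: galspanD.
move=> n [x [d [xD Pd dx dE]]]; exists n, x, d.
(* The dual system gives this expansion only on L_dif; the difference of the two sides lies in the
   span of G, so [galop_comb_dif] extends it to L. *)
have {}dE f l : galspan f -> f l = \sum_j f (x j) * d j l.
  move=> Pf; apply/eqP; rewrite -subr_eq0; apply/eqP.
  have : galspan (fun z => - 1 * (\sum_j f (x j) * d j z) + f z).
    apply: (galspanD _ _ Pf); first by rewrite rpredN rpred1.
    apply: (lincomb_closed galspan0 galspanD) => // j; exact: galspan_dif.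
  case=> m [c [g [_ Gg E]]].
  rewrite addrC -mulN1r; move/(congr1 (@^~ l)): (E) => ->.
  apply: galop_comb_dif => // s sD; move/(congr1 (@^~ s)): E => /= <-.
  by rewrite -dE // mulN1r addNr.
split=> //.
(* Both g d_j and d_j lie in the span and agree on every x_i, where the values are 0 or 1, so they
   coincide. *)
- move=> j l; apply/fixGP => g Gg; have Pgd := galspan_galop Gg (Pd j).
  rewrite [LHS](dE _ _ Pgd) /=; have [_ [g1 _] _] := Gg.
  have [gl _ _] := Gg.
  rewrite (bigD1 j) //= dx eqxx g1 mul1r big1 ?addr0 // => i iNj.
  by rewrite dx eq_sym (negPf iNj) (linear_fun0 gl) mul0r.
- by move=> j b bD; apply: galspan_dif.
- by move=> j a l m aG; apply: galspan_linear.
- by move=> l; apply: (dE _ _ galspan_id).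
Qed.

End Splitting.

(** * Operators on an extension split as A (x)_K B *)

Section SplitExtension.
Variables (K : fieldType) (L : fieldExtType K) (A B : {subfield L}).
Variables (n : nat) (x : 'I_n -> L) (d : 'I_n -> L -> L).
Hypothesis xB : forall j, x j \in B.
Hypothesis dA : forall j l, d j l \in A.
(** Coordinates of elements of B are scalars, so the x_j generating L over A also span B over K. *)
Hypothesis dB : forall j b, b \in B -> d j b \in 1%VS.
Hypothesis d_linear :
  forall j a l m, a \in A -> d j (a * l + m) = a * d j l + d j m.
Hypothesis xd : forall l, l = \sum_j x j * d j l.

Let coefA j l : subvs_of A := vsproj A (d j l).

Let val_coefA j l : vsval (coefA j l) = d j l.
Proof. exact: vsprojK. Qed.

Let coefAD j a l m : coefA j (vsval a * l + m) = a * coefA j l + coefA j m.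
Proof.
by apply: val_inj; rewrite /= !val_coefA d_linear ?subvsP.
Qed.

Let coefAZ j c l m : coefA j (c *: l + m) = c *: coefA j l + coefA j m.
Proof.
by have := coefAD j c%:A l m; rewrite /= algid1 !mulr_algl.
Qed.

Let coefA0 j : coefA j 0 = 0. Proof. exact: linear_fun0 (coefAZ j). Qed.

Let coefAM j a l : coefA j (vsval a * l) = a * coefA j l.
Proof. by rewrite -[_ * l]addr0 coefAD coefA0 addr0. Qed.

Let coefA_dB j b : b \in B -> exists c : K, coefA j b = c%:A.
Proof.
move=> /(dB j) /vlineP[c dE]; exists c; apply: val_inj.
by rewrite /= val_coefA dE algid1.
Qed.

(** The coordinates of b are scalars, so they pass through the bilinear u and reassemble b from the
    x_j. *)
Let mul_coefA (W : lmodType K) (u : subvs_of A -> subvs_of B -> W) :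
    bilinear_map u -> forall a b,
  \sum_j u (coefA j (vsval a * vsval b)) (vsproj B (x j)) = u a b.
Proof.
move=> [ul ur] a b; have /choice[c cE] j := coefA_dB j (subvsP b).
have {2}-> : b = \sum_j c j *: vsproj B (x j).
  apply: val_inj; rewrite linear_sum [LHS]xd; apply: eq_bigr => j _.
  rewrite linearZ /= vsprojK // -val_coefA cE /= algid1.
  by rewrite -scalerAr mulr1.
rewrite (linear_fun_sum (ul a)); apply: eq_bigr => j _.
by rewrite coefAM cE mulr_algr (linear_funZ (ul a)) (linear_funZ (ur _)).
Qed.

Lemma split_mul_tensor : mul_tensor A B.
Proof.
split; first split=> [a|b] c u v /=.
- by rewrite mulrDr -scalerAr.
- by rewrite mulrDl -scalerAl.
move=> W u [ul ur].
exists (fun l => \sum_j u (coefA j l) (vsproj B (x j))); split; first split.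
- move=> c l m; rewrite scaler_sumr -big_split; apply: eq_bigr => j _ /=.
  by rewrite coefAZ ur.
- by move=> a b; apply: mul_coefA.
- move=> h [hl hu]; apply/funext => l; rewrite [in RHS](xd l).
  rewrite (linear_fun_sum hl); apply: eq_bigr => j _.
  by rewrite -hu val_coefA vsprojK // mulrC.
Qed.

(** This is e (x) id_B, written in the coordinates given by the x_j. *)
Definition split_lift (e : subvs_of A -> subvs_of A) (l : L) : L :=
  \sum_j x j * vsval (e (coefA j l)).

Lemma split_linear (f : L -> L) :
  linear f -> (forall b l, b \in B -> f (b * l) = b * f l) ->
  forall l, f l = \sum_j x j * f (vsval (coefA j l)).
Proof.
move=> fl fB l; rewrite {1}(xd l) (linear_fun_sum fl).
by apply: eq_bigr => j _; rewrite fB ?val_coefA.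
Qed.

Lemma split_lift_linear e : linear e -> linear (split_lift e).
Proof.
move=> el c l m; rewrite scaler_sumr -big_split; apply: eq_bigr => j _ /=.
by rewrite coefAZ el linearP mulrDr scalerAr.
Qed.

Lemma split_liftM e : linear e -> forall a b,
  b \in B -> split_lift e (b * vsval a) = b * vsval (e a).
Proof.
move=> el a b bB; rewrite {2}(xd b) mulr_suml; apply: eq_bigr => j _.
rewrite (mulrC b) coefAM -val_coefA; have [c ->] := coefA_dB j bB.
rewrite -!scalerAr mulr1 (linear_funZ el) /= algid1 -!scalerAr -!scalerAl.
by rewrite mulr1.
Qed.

Lemma split_lift_B e b l : linear e -> b \in B ->
  split_lift e (b * l) = b * split_lift e l.
Proof.
move=> el bB; rewrite {1}(xd l) mulr_sumr.
rewrite (linear_fun_sum (split_lift_linear el)) mulr_sumr.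
apply: eq_bigr => j _; rewrite !mulrA -val_coefA.
by rewrite split_liftM // rpredM.
Qed.

(** The lift is B-linear. Writing m as the sum of x_k d_k(m), its commutator with m is therefore the
    sum of x_k times the lifts of the commutators [e, d_k(m)], which have lower order. *)
Lemma diffop_ord_split_lift i e :
  diffop_ord (subvs_of A) i e -> diffop_ord L i (split_lift e).
Proof.
elim: i e => [|i IHi] e /=.
  case=> a ->; exists (vsval a); apply/funext => l.
  rewrite {2}(xd l) mulr_sumr; apply: eq_bigr => j _.
  by rewrite /= val_coefA mulrCA.
move=> [el De]; split=> [|m]; first exact: split_lift_linear.
have := diffop_ord_sum x (fun k => IHi _ (De (coefA k m))).
congr (diffop_ord L i _); apply/funext => l.
have -> : split_lift e (m * l) - m * split_lift e l =
    \sum_k x k * (split_lift e (d k m * l) - d k m * split_lift e l).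
  rewrite {1 2}(xd m) !mulr_suml (linear_fun_sum (split_lift_linear el)) -sumrB.
  apply: eq_bigr => k _; rewrite mulrBr -!mulrA; congr (_ - _).
  by rewrite split_lift_B.
apply: eq_bigr => k _; congr (_ * _).
rewrite -val_coefA mulr_sumr -sumrB; apply: eq_bigr => j _ /=.
by rewrite coefAM mulrBr [in RHS]mulrCA.
Qed.

Lemma diffop_split_lift e :
  diffop (subvs_of A) e -> diffop L (split_lift e).
Proof. by case=> i _ De; exists i => //; apply: diffop_ord_split_lift. Qed.

(** The j-th coordinate is A-linear, so taking it commutes with forming commutators by elements of
    A. *)
Lemma diffop_ord_coef i f j : diffop_ord L i f ->
  diffop_ord (subvs_of A) i (fun a => coefA j (f (vsval a))).
Proof.
elim: i f => [|i IHi] f /=.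
  case=> l ->; exists (coefA j l); apply/funext => a.
  by rewrite mulrC coefAM mulrC.
move=> [fl Df]; split=> [c a b | a]; first by rewrite linearP fl coefAZ.
have := IHi _ (Df (vsval a)); congr (diffop_ord _ i _); apply/funext => b /=.
by rewrite -coefAM (linear_funB (coefAZ j)).
Qed.

Lemma is_tensor_op_split_lift (b : subvs_of B) e : linear e ->
  is_tensor_op ( *%R b) e (fun l => vsval b * split_lift e l : L).
Proof.
move=> el; split=> [c l m | b' a] /=.
  by rewrite (split_lift_linear el) mulrDr scalerAr.
by rewrite split_liftM ?subvsP // mulrA.
Qed.

Hypothesis diffopB :
  forall f b l, diffop L f -> b \in B -> f (b * l) = b * f l.

Lemma split_diffop_tensor_op :
  diffop L = tensor_op (mulop (subvs_of B)) (diffop (subvs_of A)).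
Proof.
apply/seteqP; split=> f.
  move=> Df; have fl := diffop_linear Df; have [i _ Dfi] := Df.
  pose e j (a : subvs_of A) := coefA j (f (vsval a)).
  have De j : diffop_ord (subvs_of A) i (e j) by apply: diffop_ord_coef.
  exists n, (fun j l => x j * split_lift (e j) l); split=> [j|].
    exists ( *%R (vsproj B (x j))), (e j); split; first by exists (vsproj B (x j)).
      by exists i.
    have := is_tensor_op_split_lift (vsproj B (x j)) (diffop_ord_linear (De j)).
    by rewrite vsprojK.
  apply/funext => l; rewrite (split_linear fl) => [|b m]; last exact: diffopB.
  under [RHS]eq_bigr do rewrite mulr_sumr.
  rewrite exchange_big; apply: eq_bigr => k _ /=.
  rewrite {1}[f _]xd mulr_sumr; apply: eq_bigr => j _.
  by rewrite /e !val_coefA mulrCA.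
move=> [m [g [Dg ->]]].
suff Dgk k : diffop L (g k).
  have := diffop_sum (fun=> 1) Dgk.
  by congr diffop; apply/funext => l; apply: eq_bigr => k _; rewrite mul1r.
have [_ [e [[b ->] De [gl ge]]]] := Dg k.
(* The products of A and B span L, so g must be b times the lift of e. *)
have := diffopD (vsval b) (diffop_split_lift De) (diffop0 _).
congr diffop; apply/funext => l; rewrite addr0 mulr_sumr [in RHS](xd l).
rewrite (linear_fun_sum gl); apply: eq_bigr => j _.
have := ge (vsproj B (x j)) (coefA j l).
by rewrite val_coefA vsprojK //= vsprojK // mulrA.
Qed.

Lemma split_diffop_tensor : diffop L = diffop_tensor A B.
Proof.
apply/seteqP; split=> f.
  (* L itself, with the two inclusions, is a model of the tensor product. *)
  move=> Df; exists L, vsval, vsval, idfun, f; split=> //.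
    exact: split_mul_tensor.
  by exists idfun.
move=> [T [i [j [phi [g [_ _ [psi phiK psiK] [k _ Dg] fE]]]]]].
exists k => //; apply: (diffop_ord_transport _ _ psiK fE Dg).
  exact: linearP.
exact: rmorphM.
Qed.

Lemma diffop_unique_lift e : diffop (subvs_of A) e ->
  exists! f : L -> L, diffop L f /\
    forall a : subvs_of A, f (vsval a) = vsval (e a).
Proof.
move=> De; have el : linear e by case: De => i _ /diffop_ord_linear.
exists (split_lift e); split.
  split=> [|a]; first exact: diffop_split_lift.
  by have := split_liftM el a (rpred1 B); rewrite !mul1r.
move=> f [Df fe]; apply/funext => l.
rewrite (split_linear (diffop_linear Df)) => [|b m]; last exact: diffopB.
by apply: eq_bigr => j _; rewrite fe.
Qed.

End SplitExtension.

(** * Change of the ground field *)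

Section BaseChange.
Variables (K : fieldType) (L : fieldExtType K) (U : {subfield L}).
Hypothesis sUdif : (U <= dif L)%VS.

(** Commutators do not involve the ground field; only linearity does. Operators over K are already
    U-linear because U lies in L_dif, and commutators inherit this. *)
Lemma diffop_fieldOver : diffop L = diffop (fieldOver U) :> set (L -> L).
Proof.
have comm_linear (f : L -> L) l :
    (forall u m, u \in U -> f (u * m) = u * f m) ->
    forall u m, u \in U -> f (l * (u * m)) - l * f (u * m) = u * (f (l * m) - l * f m).
  move=> fU u m uU; rewrite (mulrCA l u m) (fU _ m) // (fU u (l * m)) //.
  by rewrite mulrBr (mulrCA l u).
have aux i (f : L -> L) : (forall u l, u \in U -> f (u * l) = u * f l) ->
    diffop_ord L i f <-> diffop_ord (fieldOver U) i f.
  elim: i f => [|i IHi] f fU //; split=> -[fl Df]; split.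
  - move=> c a b; rewrite !fieldOver_scaleE.
    by rewrite (linear_funD fl) fU ?subvsP.
  - move=> l; apply/(IHi _ _).1; last exact: Df.
    exact: comm_linear.
  - move=> c a b; have cU : c%:A \in U by rewrite rpredZ ?rpred1.
    have := fl (vsproj U c%:A) a b.
    by rewrite !fieldOver_scaleE vsprojK // !mulr_algl.
  - move=> l; apply/(IHi _ _).2; last exact: Df.
    exact: comm_linear.
have fU f : diffop L f \/ diffop (fieldOver U) f ->
    forall u l, u \in U -> f (u * l) = u * f l.
  case=> [Df | [i _ Df]] u l uU; first by rewrite (dif_comm _ _ Df) ?(subvP sUdif).
  have := linear_funZ (diffop_ord_linear Df) (vsproj U u) l.
  by rewrite !fieldOver_scaleE vsprojK.
apply/seteqP; split=> f Df.
  by case: (Df) => i _ Dfi; exists i => //; apply/aux => //; apply: fU; left.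
by case: (Df) => i _ Dfi; exists i => //; apply/aux => //; apply: fU; right.
Qed.

End BaseChange.

(** * The Jacobson-Bourbaki theorem and B-extensions *)

Section JacobsonBourbaki.
Variables (K : fieldType) (L : fieldExtType K).

(** In dual bases x_j, d_j of P over L, every value d_j(y) centralizes P. Hence f pulls d_j(y) out
    of y = sum of x_j d_j(y), which makes f an L-combination of the d_j. *)
Lemma Jacobson_Bourbaki (P : set (L -> L)) (f : L -> L) :
    subalg_op P -> P `<=` endop L -> mulop L `<=` P ->
    endop L f ->
    (forall c, (forall g l, P g -> g (l * c) = g l * c) ->
      forall l, f (l * c) = f l * c) ->
  P f.
Proof.
move=> [Pid PD Pcomp] Pl Pmul fl fc.
have P0 : P (fun=> 0) by apply: Pmul; exists 0; apply/funext => y; rewrite mul0r.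
have PDl c g h : c \in {:L}%AS -> P g -> P h -> P (fun x => c * g x + h x).
  move=> _ Pg Ph; have := PD 1 _ _ (Pcomp _ _ (Pmul _ (ex_intro _ c erefl)) Pg) Ph.
  by congr P; apply/funext => y; rewrite scale1r.
have [] := @dual_system K L {:L}%AS P => //; first by move=> g x _ _; apply: memvf.
move=> n [x [d [_ Pd dx dE]]].
have dc j y g l : P g -> g (l * d j y) = g l * d j y.
  have dd i m : d i (m * d j y) = d i m * d j y.
    (* This composite sends x_j to d_i(m) and the other x_k to 0, so its expansion in the dual basis
       is d_i(m) d_j. *)
    have Pdd : P (d i \o ( *%R m \o d j)).
      by apply: (Pcomp) => //; apply: (Pcomp) => //; apply: Pmul; exists m.
    have := dE _ y Pdd (memvf _); rewrite /= => ->.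
    rewrite (bigD1 j) //= dx eqxx mulr1 big1 ?addr0 // => k kNj.
    by rewrite dx eq_sym (negPf kNj) mulr0 (linear_fun0 (Pl _ (Pd i))) mul0r.
  move=> Pg; rewrite (dE g (_ * _)) ?memvf // (dE g l) ?memvf // mulr_suml.
  by apply: eq_bigr => i _; rewrite dd mulrA.
suff -> : f = fun y => \sum_j f (x j) * d j y.
  by apply: (lincomb_closed P0 PDl) => // j; apply: memvf.
apply/funext => y; rewrite {1}[y](dE _ _ Pid) ?memvf // (linear_fun_sum fl).
by apply: eq_bigr => j _; apply: fc => g l; apply: dc.
Qed.

Lemma gen_subalg_subset (S P : set (L -> L)) :
  subalg_op P -> S `<=` P -> gen_subalg S `<=` P.
Proof. by move=> PA SP f; apply. Qed.

Lemma gen_subalgP (S : set (L -> L)) : subalg_op (gen_subalg S).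
Proof.
split=> [P PA _ | c f g Sf Sg P PA SP | f g Sf Sg P PA SP];
  have [Pid PD Pcomp] := PA => //.
- by apply: PD; [apply: Sf | apply: Sg].
- by apply: Pcomp; [apply: Sf | apply: Sg].
Qed.

Lemma endop_subalg : subalg_op (endop L).
Proof.
split=> [c x y | c f g fl gl a x y | f g fl gl a x y] //=.
  by rewrite fl gl !scalerDr !scalerA (mulrC c) addrACA.
by rewrite gl fl.
Qed.

Lemma fixGdif_eq1_Bext : fixGdif L = 1%AS <-> is_Bext L.
Proof.
split=> [F1 | bext].
  apply/seteqP; split.
    apply: gen_subalg_subset; first exact: endop_subalg.
    by move=> f [/diffop_linear | [fl]].
  move=> f fl; apply: Jacobson_Bourbaki => //; first exact: gen_subalgP.
  - apply: gen_subalg_subset; first exact: endop_subalg.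
    by move=> g [/diffop_linear | [gl]].
  - by move=> g [l ->] P _; apply; left; apply: diffop_mul.
  move=> c cP l; have : c \in fixGdif L.
    rewrite memv_cap; apply/andP; split.
      apply/fixGP => g Gg; have := cP g 1; have [_ [-> _] _] := Gg.
      by rewrite !mul1r; apply=> P _; apply; right.
    apply/difP => g Dg; apply/funext => y /=; rewrite mulrC -cP 1?mulrC //.
    by move=> P _; apply; left.
  by rewrite F1 => /vlineP[k ->]; rewrite !mulr_algr (linear_funZ fl).
apply/val_inj/eqP; rewrite eqEsubv sub1v andbT; apply/subvP => c.
rewrite memv_cap => /andP[cG cD].
have comm f : endop L f -> forall l, f (c * l) = c * f l.
  rewrite -bext; apply: (gen_subalg_subset (P := [set g | forall l, g (c * l) = c * g l])).
    split=> [l | k g h gc hc l | g h gc hc l] //=.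
      by rewrite gc hc mulrDr scalerAr.
    by rewrite hc gc.
  move=> g [Dg | Gg] l; first exact: dif_comm.
  by have [_ [_ ->] _] := Gg; rewrite (fixG_fix cG).
have /comm/(_ 1) : endop L (projv 1) by apply: linearP.
by rewrite mulr1 (projv_id (mem1v 1%AS)) mulr1 => <-; apply: memv_proj.
Qed.

(** For c in both factors, c (x) 1 and 1 (x) c have the same product. Applying a K-linear projection
    onto K to the first factor gives c equal to its own projection. *)
Lemma fixGdif_eq1_mul_tensor : mul_tensor (fixG L) (dif L) -> fixGdif L = 1%AS.
Proof.
move=> [_ univ]; apply/val_inj/eqP; rewrite eqEsubv sub1v andbT; apply/subvP => c.
rewrite memv_cap => /andP[cG cD].
pose u (a : subvs_of (fixG L)) (b : subvs_of (dif L)) : L :=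
  projv 1 (vsval a) * vsval b.
have [|h [[_ hu] _]] := univ L u.
  split=> [a | b] k y z; rewrite /u.
    by rewrite linearP /= mulrDr scalerAr.
  by rewrite !linearP /= mulrDl scalerAl.
have := hu (vsproj _ c) 1; have := hu 1 (vsproj _ c).
rewrite /u !vsprojK //= !algid1 mulr1 mul1r => ->.
by rewrite (projv_id (mem1v 1%AS)) mul1r mulr1 => ->; apply: memv_proj.
Qed.
End JacobsonBourbaki.

Theorem theorem5p20 (K : fieldType) (p : nat) (charK : p \in [pchar K])
    (L : fieldExtType K) :
  [/\ diffop L = diffop (fieldOver (dif L)) :> set (L -> L),
      diffop (fieldOver (dif L)) = diffop_tensor (fixG_over L) (dif_over L)
        :> set (L -> L),
      diffop_tensor (fixG_over L) (dif_over L)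
      = tensor_op (mulop (subvs_of (dif_over L)))
                  (diffop (subvs_of (fixG_over L))) :> set (L -> L)
    & forall d, diffop (subvs_of (fixG_over L)) d ->
      exists! f : L -> L, diffop L f /\
        forall a : subvs_of (fixG_over L), f (vsval a) = vsval (d a)]
  /\
  [/\ fixGdif L = 1%AS <-> mul_tensor (fixG L) (dif L),
      fixGdif L = 1%AS <-> is_Bext L
    & fixGdif L = 1%AS ->
      diffop L = diffop_tensor (fixG L) (dif L) /\
      diffop_tensor (fixG L) (dif L)
      = tensor_op (mulop (subvs_of (dif L))) (diffop (subvs_of (fixG L)))].
Proof.
have [n [x [d [xD dG dD d_lin xd]]]] := fixG_dif_split L charK.
have d_F j b : b \in dif L -> d j b \in fixGdif L.
  by move=> bD; rewrite memv_cap dG dD.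
split; last first.
  have d_1 : fixGdif L = 1%AS -> forall j b, b \in dif L -> d j b \in 1%VS.
    by move=> F1 j b /(d_F j); rewrite F1.
  have difB f b l : diffop L f -> b \in dif L -> f (b * l) = b * f l.
    by move=> Df bD; apply: dif_comm.
  split; first split=> [/d_1 dK|].
  - exact: split_mul_tensor xD dG dK d_lin xd.
  - exact: fixGdif_eq1_mul_tensor.
  - exact: fixGdif_eq1_Bext.
  move=> /d_1 dK; rewrite -(split_diffop_tensor xD dG dK d_lin xd).
  by rewrite -(split_diffop_tensor_op xD dG dK d_lin xd difB).
have sFD : (fixGdif L <= dif L)%VS by apply: capvSr.
have sFG : (fixGdif L <= fixG L)%VS by apply: capvSl.
pose LF := fieldOver (fixGdif L).
have memG (l : LF) : (l \in fixG_over L) = (l \in fixG L) by rewrite mem_aspaceOver.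
have memD (l : LF) : (l \in dif_over L) = (l \in dif L) by rewrite mem_aspaceOver.
have DF := diffop_fieldOver sFD; have DD := diffop_fieldOver (subvv (dif L)).
have xD' (j : 'I_n) : (x j : LF) \in dif_over L by rewrite memD.
have dG' (j : 'I_n) (l : LF) : (d j l : LF) \in fixG_over L by rewrite memG.
(* Over the ground field F the scalars are exactly F, so the coordinates of elements of L_dif become
   scalars. *)
have dK' (j : 'I_n) (b : LF) : b \in dif_over L -> (d j b : LF) \in 1%VS.
  by rewrite memD trivial_fieldOver => /d_F.
have d_lin' (j : 'I_n) (a l m : LF) : a \in fixG_over L ->
    (d j (a * l + m) : LF) = a * d j l + d j m.
  by rewrite memG; apply: d_lin.
have xd' (l : LF) : l = \sum_j (x j : LF) * d j l by exact: xd.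
have difB' (f : LF -> LF) (b l : LF) : diffop LF f -> b \in dif_over L ->
    f (b * l) = b * f l.
  by rewrite memD => Df bD; apply: (@dif_comm K L) bD _; rewrite DF.
have ET := split_diffop_tensor xD' dG' dK' d_lin' xd'.
have EO := split_diffop_tensor_op xD' dG' dK' d_lin' xd' difB'.
split=> //.
- by rewrite -DD DF.
- by rewrite -ET.
- move=> e De.
  rewrite DF; exact: (diffop_unique_lift xD' dG' dK' d_lin' xd' difB' De).
Qed.
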